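(* Noncommutative polynomials $f_1,\dots,f_t\in F\langle X\rangle$ are $M_n$-locally linearly dependent if and only if there exist central polynomials $c_1,\dots,c_t$ of $M_n$, not all of them polynomial identities of $M_n$, such that $\sum_{i=1}^tc_if_i$ is a polynomial identity of $M_n$.
   Context: $F$ is a field of characteristic $0$, $M_n=M_n(F)$, $F\langle X\rangle$ the free algebra on noncommuting $X=\{x_1,x_2,\dots\}$. Polynomials $f_1,\dots,f_t\in F\langle x_1,\dots,x_m\rangle$ are $M_n$-locally linearly dependent if $f_1(r_1,\dots,r_m),\dots,f_t(r_1,\dots,r_m)$ are linearly dependent over $F$ for all $r_1,\dots,r_m\in M_n$. A central polynomial of $M_n$ is an element of $F\langle X\rangle$ all of whose evaluations in $M_n$ are scalar matrices (constants included); a polynomial identity is one all of whose evaluations are $0$. *)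

(* Defs.v *)
From HB Require Import structures.
From mathcomp Require Import all_boot all_order all_algebra.
Set Implicit Arguments. Unset Strict Implicit. Unset Printing Implicit Defensive.
Import GRing.Theory.
Local Open Scope ring_scope.

(* Noncommutative polynomials in F<x_0, x_1, ...>: finite formal sums of
   (coefficient, monomial) pairs, a monomial being a word in the variable
   indices. Equal polynomials may have several representations; all notions
   below only depend on evaluations, hence on the polynomial itself. *)
Definition ncpoly (F : Type) := seq (F * seq nat).

Definition ncmul (F : fieldType) (p q : ncpoly F) : ncpoly F :=
  [seq (a.1 * b.1, a.2 ++ b.2) | a <- p, b <- q].

Definition ncadd (F : Type) (p q : ncpoly F) : ncpoly F := p ++ q.

Definition nclincomb (F : fieldType) (t : nat) (c f : 'I_t -> ncpoly F)
  : ncpoly F := \big[@ncadd F/[::]]_(i < t) ncmul (c i) (f i).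

Definition nceval (F : fieldType) (n : nat) (p : ncpoly F)
  (r : nat -> 'M[F]_n) : 'M[F]_n :=
  \sum_(m <- p) m.1 *: \prod_(i <- m.2) r i.

Definition loc_lin_dep (F : fieldType) (n t : nat) (f : 'I_t -> ncpoly F) :=
  forall r : nat -> 'M[F]_n,
    ~~ free [seq nceval (f i) r | i <- enum 'I_t].

Definition central_poly (F : fieldType) (n : nat) (c : ncpoly F) :=
  forall r : nat -> 'M[F]_n, is_scalar_mx (nceval c r).

Definition poly_identity (F : fieldType) (n : nat) (c : ncpoly F) :=
  forall r : nat -> 'M[F]_n, nceval c r = 0.

(* Main.v *)
Require Import Defs.
From HB Require Import structures.
From mathcomp Require Import all_boot all_order all_algebra all_fingroup.
From Stdlib Require Import Classical_Prop Classical_Pred_Type.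
Set Implicit Arguments. Unset Strict Implicit. Unset Printing Implicit Defensive.
Import GRing.Theory.
Local Open Scope ring_scope.

(** With [N = n^2], summing over [s : 'S_N] with signs all the cyclic rotations
    of [a_1 x_(s 1) b_1 ... a_N x_(s N) b_N] that start at some [x_(s j)] gives
    a polynomial [P(x)] with [\tr (z P(x)) = \sum_i D(.., z x_i, ..)], where
    [D(x) = \sum_s sgn(s) \tr (a_1 x_(s 1) b_1 ... a_N x_(s N) b_N)].  As [D] is
    alternating in [N = dim M_n] arguments, [D(x)] is [\det x] times a scalar
    depending only on [a] and [b], so the right-hand side is the trace of left
    multiplication by [z] times [D(x)], that is [n \tr(z) D(x)].  Hence
    [P(x) = n D(x)] is a scalar matrix: [P] is a central polynomial that is
    alternating in [x] and does not vanish on bases.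

    If [f_0, .., f_(t-1)] are independent at some point while [f_0, .., f_t]
    are dependent at every point, Cramer's rule for [P(f_0, .., f_(t-1), x)],
    with the remaining arguments fresh variables, is a relation with central
    coefficients.  Conversely, given such a relation, on the line joining a
    point of independence to a point where a coefficient does not vanish, the
    product of two nonzero one-variable polynomials would vanish. *)

(** * Evaluation of noncommutative polynomials and rank of a family of values *)

Section Eval.
Variables (F : fieldType) (n : nat).
Implicit Types (p q : ncpoly F) (r : nat -> 'M[F]_n).

Lemma nceval_nil r : nceval [::] r = 0.
Proof. exact: big_nil. Qed.

Lemma nceval_add p q r : nceval (ncadd p q) r = nceval p r + nceval q r.
Proof. exact: big_cat. Qed.

Lemma nceval_mul p q r : nceval (ncmul p q) r = nceval p r *m nceval q r.
Proof.
rewrite /nceval /ncmul big_flatten big_map mulmx_suml; apply: eq_bigr => a _.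
rewrite big_map mulmx_sumr; apply: eq_bigr => b _ /=.
by rewrite big_cat -scalemxAl -scalemxAr scalerA.
Qed.

Definition ncvar (i : nat) : ncpoly F := [:: (1, [:: i])].
Definition ncconst (a : F) : ncpoly F := [:: (a, [::])].

Lemma nceval_var i r : nceval (ncvar i) r = r i.
Proof. by rewrite /nceval !big_seq1 scale1r. Qed.

Lemma nceval_const a r : nceval (ncconst a) r = a%:M.
Proof. by rewrite /nceval big_seq1 big_nil scalemx1. Qed.

Lemma nceval_sum (I : Type) (s : seq I) (G : I -> ncpoly F) r :
  nceval (\big[@ncadd F/[::]]_(i <- s) G i) r = \sum_(i <- s) nceval (G i) r.
Proof.
by apply: (big_morph (fun p => nceval p r)) => [p q|];
  rewrite ?nceval_add ?nceval_nil.
Qed.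

Lemma nceval_prod (I : Type) (s : seq I) (G : I -> ncpoly F) r :
  nceval (\big[@ncmul F/ncconst 1]_(i <- s) G i) r =
  \prod_(i <- s) nceval (G i) r.
Proof.
by apply: (big_morph (fun p => nceval p r)) => [p q|];
  rewrite ?nceval_mul ?nceval_const.
Qed.

Lemma nceval_lincomb t (c f : 'I_t -> ncpoly F) r :
  nceval (nclincomb c f) r = \sum_(i < t) nceval (c i) r *m nceval (f i) r.
Proof. by rewrite nceval_sum; apply: eq_bigr => i _; rewrite nceval_mul. Qed.

Definition ncbound p : nat := (\max_(m <- p) \max_(i <- m.2) i.+1)%N.

Lemma nceval_eq_below p r r' M : (ncbound p <= M)%N ->
  (forall i, (i < M)%N -> r i = r' i) -> nceval p r = nceval p r'.
Proof.
move=> leM eqr; rewrite /nceval big_seq [RHS]big_seq.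
apply: eq_bigr => m m_p; congr (_ *: _).
rewrite big_seq [RHS]big_seq; apply: eq_bigr => i i_m; apply: eqr.
apply: leq_trans leM; apply: leq_trans (leq_bigmax_seq _ m_p isT) => /=.
exact: (@leq_bigmax_seq _ _ _ (fun i => i.+1) _ i_m isT).
Qed.

Definition evalmx t (f : 'I_t -> ncpoly F) r : 'M[F]_(t, n * n) :=
  \matrix_(i < t) mxvec (nceval (f i) r).

Lemma mul_evalmx t (f : 'I_t -> ncpoly F) r (a : 'rV_t) :
  a *m evalmx f r = mxvec (\sum_i a 0 i *: nceval (f i) r).
Proof.
rewrite mulmx_sum_row linear_sum /=; apply: eq_bigr => i _.
by rewrite rowK linearZ.
Qed.

Lemma row_free_evalmx t (f : 'I_t -> ncpoly F) r :
  free [seq nceval (f i) r | i <- enum 'I_t] = row_free (evalmx f r).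
Proof.
have -> : [seq nceval (f i) r | i <- enum 'I_t] = 
  [tuple nceval (f i) r | i < t] by [].
apply/freeP/idP => [frf | frf k k0 i].
  apply: inj_row_free => v; rewrite mul_evalmx => /(canRL mxvecK).
  rewrite linear0 => v0; apply/rowP => i; rewrite mxE.
  apply: (frf (v 0)); rewrite -[RHS]v0; apply: eq_bigr => j _.
  by rewrite (nth_mktuple (fun i => nceval (f i) r)).
have /(row_free_inj frf) : (\row_i k i) *m evalmx f r = 0 *m evalmx f r.
  rewrite mul0mx mul_evalmx -[RHS](linear0 mxvec); congr mxvec.
  rewrite -[RHS]k0; apply: eq_bigr => j _.
  by rewrite mxE (nth_mktuple (fun i => nceval (f i) r)).
by move/rowP/(_ i); rewrite !mxE.
Qed.

End Eval.

(** * Determinants with one row replaced, and the trace of left multiplication *)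

Section Det.
Variable F : fieldType.

Lemma det_set_row N (X : 'M[F]_N) (v : 'rV_N) (i : 'I_N) :
  \det (\matrix_k (if k == i then v else row k X)) = (v *m \adj X) 0 i.
Proof.
rewrite (expand_det_row _ i) mxE; apply: eq_bigr => j _.
rewrite !mxE eqxx; congr (_ * _); rewrite /cofactor; congr (_ * \det _).
by apply/matrixP => a b; rewrite !mxE eq_sym (negbTE (neq_lift _ _)) mxE.
Qed.

(** Each summand is a diagonal entry of [X *m A *m \adj X]; the trace of this product is cyclic. *)
Lemma sum_det_set_row_mul N (X A : 'M[F]_N) :
  \sum_i \det (\matrix_k (if k == i then row i (X *m A) else row k X)) =
  \tr A * \det X.
Proof.
transitivity (\tr (X *m A *m \adj X)).
  apply: eq_bigr => i _; rewrite det_set_row !mxE.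
  by apply: eq_bigr => j _; rewrite mxE.
by rewrite mxtrace_mulC mulmxA mul_adj_mx -scalemx1 -scalemxAl mul1mx mxtraceZ mulrC.
Qed.

Lemma cramer_row N (X : 'M[F]_N) (v : 'rV_N) :
  \det X *: v =
  \sum_i \det (\matrix_k (if k == i then v else row k X)) *: row i X.
Proof.
transitivity (v *m \adj X *m X).
  by rewrite -mulmxA mul_adj_mx mul_mx_scalar.
by rewrite mulmx_sum_row; apply: eq_bigr => i _; rewrite det_set_row.
Qed.

(** On the matrix unit $E_{ij}$, left multiplication by [z] has diagonal coefficient [z i i], for
    each of the [n] values of [j]. *)
Lemma mxtrace_lin_mulmx n (z : 'M[F]_n) :
  \tr (lin_mulmx z : 'M_(n * n)) = n%:R * \tr z.
Proof.
rewrite /mxtrace (reindex (uncurry (@mxvec_index n n))) /=; last first.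
  exact: curry_mxvec_bij.
transitivity (\sum_i \sum_(j < n) z i i).
  rewrite pair_bigA; apply: eq_bigr => -[i j] _ /=.
  rewrite mxE /= -mxvec_delta mxvecK mxvecE.
  rewrite mxE (bigD1 i) //= mxE !eqxx mulr1 big1 ?addr0 // => k ki.
  by rewrite mxE (negbTE ki) mulr0.
by rewrite mulr_sumr; apply: eq_bigr => i _; rewrite sumr_const card_ord mulr_natl.
Qed.

End Det.

(** * The alternating trace form and its central polynomial, on matrices *)

Section Capelli.
Variables (F : fieldType) (n : nat).
Local Notation N := (n * n)%N.
Implicit Types (x a b : 'I_N -> 'M[F]_n) (z : 'M[F]_n).

Definition vecrows x : 'M[F]_N := \matrix_i mxvec (x i).

Definition capelli_trace a b x : F :=
  \sum_(s : 'S_N) (-1) ^+ s * \tr (\prod_k (a k *m x (s k) *m b k)).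

Definition capelli_scale a b : F :=
  \sum_(g : {ffun 'I_N -> 'I_N}) \det (colsub g 1%:M : 'M[F]_N) *
    \tr (\prod_k (a k *m vec_mx (delta_mx 0 (g k)) *m b k)).

Lemma prod_scalemx m (I : Type) (r : seq I) (c : I -> F) (A : I -> 'M[F]_m) :
  \prod_(i <- r) (c i *: A i) = (\prod_(i <- r) c i) *: \prod_(i <- r) A i.
Proof.
elim: r => [|i r IHr]; first by rewrite !big_nil scale1r.
by rewrite !big_cons IHr -!mulmxE -scalemxAl -scalemxAr scalerA.
Qed.

(** Each [x (s k)] is expanded in matrix units, [g] recording the unit chosen at place [k]. For
    fixed [g], the signed sum over [s] is the Leibniz formula for the columns of [vecrows x]
    selected by [g]. *)
Lemma capelli_traceE a b x :
  capelli_trace a b x = \det (vecrows x) * capelli_scale a b.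
Proof.
transitivity (\sum_(s : 'S_N) \sum_(g : {ffun 'I_N -> 'I_N})
    (-1) ^+ s * \prod_k vecrows x (s k) (g k) *
    \tr (\prod_k (a k *m vec_mx (delta_mx 0 (g k)) *m b k))).
  apply: eq_bigr => s _.
  have -> : \prod_k (a k *m x (s k) *m b k) =
      \prod_k \sum_p (vecrows x (s k) p *:
                         (a k *m vec_mx (delta_mx 0 p) *m b k)).
    apply: eq_bigr => k _.
    rewrite -[x (s k)]mxvecK [mxvec _]row_sum_delta linear_sum /=.
    rewrite mulmx_sumr mulmx_suml; apply: eq_bigr => p _.
    by rewrite linearZ /= -scalemxAr -scalemxAl mxE.
  rewrite (bigA_distr_bigA (fun k p => vecrows x (s k) p *:
                         (a k *m vec_mx (delta_mx 0 p) *m b k))).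
  rewrite linear_sum mulr_sumr; apply: eq_bigr => g _ /=.
  by rewrite prod_scalemx mxtraceZ mulrA.
rewrite exchange_big mulr_sumr; apply: eq_bigr => g _ /=.
rewrite -mulr_suml mulrA -det_mulmx; congr (_ * _).
rewrite mulmx_colsub mulmx1 -det_tr; apply: eq_bigr => s _.
by congr (_ * _); apply: eq_bigr => k _; rewrite !mxE.
Qed.

Definition capelli_central a b x : 'M[F]_n :=
  \sum_(s : 'S_N) (-1) ^+ s *: \sum_(j < N)
    (x (s j) *m b j *m
     (\prod_(k <- drop j.+1 (enum 'I_N)) (a k *m x (s k) *m b k)) *m
     (\prod_(k <- take j (enum 'I_N)) (a k *m x (s k) *m b k)) *m a j).

Lemma mxtrace_capelli_central a b x z :
  \tr (z *m capelli_central a b x) =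
  \sum_i capelli_trace a b (fun k => if k == i then z *m x i else x k).
Proof.
rewrite /capelli_trace exchange_big mulmx_sumr linear_sum /=.
apply: eq_bigr => s _; rewrite -scalemxAr mxtraceZ -mulr_sumr; congr (_ * _).
(* With [i = s j], the factor carrying [z] stands at place [j] of the word; cyclicity of the trace
   then brings [z] to the front. *)
rewrite [RHS](reindex_inj (@perm_inj _ s)) mulmx_sumr linear_sum /=.
apply: eq_bigr => j _.
have -> : \prod_k (a k *m (if s k == s j then z *m x (s j) else x (s k)) *m b k)
  = (\prod_(k <- take j (enum 'I_N)) (a k *m x (s k) *m b k)) *m
    (a j *m (z *m x (s j)) *m b j) *m
    (\prod_(k <- drop j.+1 (enum 'I_N)) (a k *m x (s k) *m b k)).
  transitivity (\prod_(k <- enum 'I_N)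
      (a k *m (if s k == s j then z *m x (s j) else x (s k)) *m b k)).
    by rewrite [index_enum _]unlock -enumT.
  have szE : (j < size (enum 'I_N))%N by rewrite size_enum_ord.
  have nthj : nth j (enum 'I_N) j = j by rewrite nth_ord_enum.
  have uE : uniq (take j (enum 'I_N) ++ j :: drop j.+1 (enum 'I_N)).
    by rewrite -{2}nthj -drop_nth // cat_take_drop enum_uniq.
  rewrite -{1}[enum 'I_N](cat_take_drop j) (drop_nth j szE) nthj.
  move: uE; rewrite cat_uniq /= negb_or => /and3P[_ /andP[jt _] /andP[jd _]].
  rewrite big_cat big_cons eqxx /= -[RHS]mulmxA.
  by congr (_ * (_ * _)); rewrite big_seq [RHS]big_seq; apply: eq_bigr => k kE;
    rewrite (inj_eq perm_inj) (negbTE (memPn _ _ kE)).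
move: (\prod_(k <- take _ _) _) (\prod_(k <- drop _ _) _) => T D.
by rewrite -[T *m _ *m D]mulmxA [RHS]mxtrace_mulC !mulmxA [LHS]mxtrace_mulC !mulmxA.
Qed.

Lemma capelli_central_scalar a b x :
  capelli_central a b x =
  (n%:R * (\det (vecrows x) * capelli_scale a b))%:M.
Proof.
have trz z : \tr (z *m capelli_central a b x) =
    \tr z * (n%:R * (\det (vecrows x) * capelli_scale a b)).
  rewrite mxtrace_capelli_central.
  under eq_bigr do rewrite capelli_traceE.
  rewrite -mulr_suml !mulrA; congr (_ * _).
  (* Replacing [x i] by [z *m x i] applies [lin_mulmx z] to row [i] of [vecrows x]. *)
  rewrite [\tr z * _]mulrC -mxtrace_lin_mulmx -sum_det_set_row_mul.
  apply: eq_bigr => i _; congr (\det _); apply/row_matrixP => k.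
  rewrite !rowK; case: eqP => _ //.
  by rewrite row_mul rowK mul_vec_lin.
(* The trace against [delta_mx j i] reads off the entry at [(i, j)]. *)
apply/matrixP => i j; rewrite !mxE.
have := trz (delta_mx j i).
rewrite {1}/mxtrace (bigD1 j) //= big1 => [|k kj]; last first.
  by rewrite mxE big1 // => l _; rewrite mxE (negbTE kj) mul0r.
rewrite addr0 mxE (bigD1 i) //= big1 => [|k ki]; last first.
  by rewrite mxE (negbTE ki) andbF mul0r.
rewrite mxE !eqxx mul1r addr0 => ->.
rewrite /mxtrace (bigD1 j) //= big1 => [|k kj]; last first.
  by rewrite mxE (negbTE kj).
by rewrite mxE eqxx addr0 /= eq_sym mulr_natl.
Qed.

End Capelli.

(** * Nonvanishing and formal version of the central polynomial *)

Section Central.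
Variables (F : fieldType) (n : nat).
Local Notation N := (n * n)%N.

(** When [k] indexes $E_{ij}$, take $a_k = E_{0i}$ and $b_k = E_{j0}$: then $a_k E b_k$ is $E_{00}$
    for the [k]-th matrix unit $E$ and zero for the others, so only the identity [g] contributes. *)
Lemma capelli_scale_neq0 : (0 < n)%N ->
  exists a b : 'I_N -> 'M[F]_n, capelli_scale a b != 0.
Proof.
move=> n_gt0; pose i0 := Ordinal n_gt0.
have [d dK Kd] := curry_mxvec_bij n n.
exists (fun k => delta_mx i0 (d k).1), (fun k => delta_mx (d k).2 i0).
have entry k p : delta_mx i0 (d k).1 *m vec_mx (delta_mx 0 p) *m
    delta_mx (d k).2 i0 = (p == k)%:R *: delta_mx i0 i0 :> 'M[F]_n.
  have -> : (p == k) = (d p == d k).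
    by apply/eqP/eqP => [->//|/(congr1 (uncurry (@mxvec_index n n)))]; rewrite !Kd.
  rewrite -{1}[p]Kd ?inE // /uncurry; case: (d p) (d k) => [i j] [i' j'] /=.
  rewrite vec_mx_delta mul_delta_mx_cond -scaler_nat -scalemxAl mul_delta_mx_cond.
  by rewrite !scaler_nat -mulrnA mulnb xpair_eqE andbC (eq_sym i).
have prodE m : \prod_(k < m.+1) delta_mx i0 i0 = delta_mx i0 i0 :> 'M[F]_n.
  elim: m => [|m IHm]; first by rewrite big_ord1.
  by rewrite big_ord_recl IHm -mulmxE mul_delta_mx.
have trE (g : {ffun 'I_N -> 'I_N}) : \tr (\prod_k (delta_mx i0 (d k).1 *m
    vec_mx (delta_mx 0 (g k)) *m delta_mx (d k).2 i0)) =
    \prod_k (g k == k)%:R :> F.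
  under eq_bigr do rewrite entry.
  rewrite prod_scalemx mxtraceZ.
  have -> : \tr (\prod_(k < N) delta_mx i0 i0) = 1 :> F.
    rewrite -(@prednK N) ?muln_gt0 ?n_gt0 // prodE /mxtrace (bigD1 i0) //=.
    rewrite mxE !eqxx big1 ?addr0 // => k /negbTE ki.
    by rewrite mxE ki.
  by rewrite mulr1.
rewrite /capelli_scale (bigD1 [ffun k => k]) //= [X in _ + X]big1 => [|g].
  rewrite addr0 trE big1 => [|k _]; last by rewrite ffunE eqxx.
  have -> : colsub [ffun k => k] 1%:M = 1%:M :> 'M[F]_N.
    by apply/matrixP => i j; rewrite !mxE ffunE.
  by rewrite det1 mulr1 oner_neq0.
move=> g_id; have /existsP[k gk] : [exists k, g k != k].
  rewrite -negb_forall; apply: contra g_id => /forallP g_id.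
  by apply/eqP/ffunP => k; rewrite ffunE; apply/eqP.
by rewrite trE (bigD1 k) //= (negbTE gk) mul0r mulr0.
Qed.

(* Variables of index at least [M], fresh for polynomials with [ncbound] at most
   [M]; [l = 0, 1, 2] selects the families [a], [b] and [x]. *)
Definition cap_var (M l : nat) (k : 'I_N) : nat := (M + pickle (l, k))%N.

Definition nccapelli (M : nat) (q : 'I_N -> ncpoly F) : ncpoly F :=
  let a k := ncvar F (cap_var M 0 k) in
  let b k := ncvar F (cap_var M 1 k) in
  let w (s : 'S_N) k := ncmul (a k) (ncmul (q (s k)) (b k)) in
  \big[@ncadd F/[::]]_(s : 'S_N) \big[@ncadd F/[::]]_(j < N)
    ncmul (ncconst ((-1) ^+ s)) (ncmul (q (s j)) (ncmul (b j) (ncmul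
      (\big[@ncmul F/ncconst 1]_(k <- drop j.+1 (enum 'I_N)) w s k) (ncmul
      (\big[@ncmul F/ncconst 1]_(k <- take j (enum 'I_N)) w s k) (a j))))).

Lemma nceval_capelli M q (r : nat -> 'M[F]_n) :
  nceval (nccapelli M q) r =
  (n%:R * (\det (vecrows (fun k => nceval (q k) r)) *
     capelli_scale (fun k => r (cap_var M 0 k)) (fun k => r (cap_var M 1 k))))%:M.
Proof.
rewrite -capelli_central_scalar nceval_sum; apply: eq_bigr => s _.
rewrite nceval_sum scaler_sumr; apply: eq_bigr => j _.
rewrite !nceval_mul nceval_const mul_scalar_mx !nceval_prod !nceval_var.
have wE k : nceval (ncmul (ncvar F (cap_var M 0 k))
    (ncmul (q (s k)) (ncvar F (cap_var M 1 k)))) r =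
  r (cap_var M 0 k) *m nceval (q (s k)) r *m r (cap_var M 1 k).
  by rewrite !nceval_mul !nceval_var mulmxA.
by rewrite !(eq_bigr _ (fun k _ => wE k)) !mulmxA.
Qed.

Lemma row_free_complete m p (A : 'M[F]_(m, p)) (le_mp : (m <= p)%N) :
  row_free A -> exists2 U : 'M[F]_p, U \in unitmx &
    forall i, row i A = row (widen_ord le_mp i) U.
Proof.
move=> /eqP rankA.
(* [pid_mx m *m A] is [A] padded with zero rows to a square matrix, and [P] selects its first [m]
   rows. *)
pose P : 'M[F]_(m, p) := pid_mx m.
have PA : P *m ((pid_mx m : 'M_(p, m)) *m A) = A.
  by rewrite mulmxA pid_mx_id // pid_mx_1 mul1mx.
have rankP : \rank (P *m ((pid_mx m : 'M_(p, m)) *m A)) = \rank P.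
  by rewrite PA rankA rank_pid_mx.
have [U Uunit PU] := complete_unitmx rankP.
exists U => // i; rewrite -PA PU row_mul [RHS]rowE; congr (_ *m U).
by apply/rowP => j; rewrite !mxE ltn_ord andbT eqxx eq_sym.
Qed.

End Central.

(** * From a central relation to local dependence *)

Section Backward.
Variables (F : fieldType) (char0 : [pchar F] =i pred0).

Lemma natr_inj_pchar0 : injective (fun m => m%:R : F).
Proof.
have inj m k : (m <= k)%N -> m%:R = k%:R :> F -> m = k.
  move=> le_mk /eqP; rewrite eq_sym -subr_eq0 -natrB // (proj1 (pcharf0P F) char0).
  by rewrite subn_eq0 => le_km; apply/eqP; rewrite eqn_leq le_mk.
move=> m k /= mk; case/orP: (leq_total m k) => le_mk; first exact: inj.
by apply/esym/inj.
Qed.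

Lemma poly_eq0_pchar0 (p : {poly F}) : (forall x, p.[x] = 0) -> p = 0.
Proof.
move=> p0; apply/eqP; apply: contraT => p_neq0.
have := max_poly_roots p_neq0 (rs := [seq i%:R | i <- iota 0 (size p)]).
rewrite size_map size_iota ltnn; apply.
  by apply/allP => x _; apply/rootP.
by rewrite map_inj_uniq ?iota_uniq //; exact: natr_inj_pchar0.
Qed.

Variable n : nat.

Definition line (r s : nat -> 'M[F]_n) (x : F) k := r k + x *: (s k - r k).

Lemma nceval_line (p : ncpoly F) r s : exists P : 'M[{poly F}]_n,
  forall x, nceval p (line r s x) = map_mx (horner_eval x) P.
Proof.
exists (\sum_(m <- p) m.1%:P *: \prod_(i <- m.2)
   (map_mx polyC (r i) + 'X *: map_mx polyC (s i - r i))) => x.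
rewrite (big_morph _ (@map_mxD _ _ (horner_eval x) n n) (map_mx0 _ n n)); apply: eq_bigr => m _.
rewrite map_mxZ /= horner_evalE hornerC; congr (_ *: _).
rewrite (big_morph _ (@map_mxM _ _ (horner_eval x) n n n) (map_mx1 _ n)); apply: eq_bigr => i _.
rewrite map_mxD map_mxZ /= horner_evalE hornerX /line.
by congr (_ + _ *: _); apply/matrixP => a b; rewrite !mxE horner_evalE hornerC.
Qed.

Lemma central_comb_loc_lin_dep t (c f : 'I_t -> ncpoly F) i :
  (forall j, central_poly n (c j)) -> ~ poly_identity n (c i) ->
  poly_identity n (nclincomb c f) -> loc_lin_dep n f.
Proof.
move=> c_central ci_nid cf0 r; apply/negP; rewrite row_free_evalmx.
move=> /row_freeP[B fB]; apply: ci_nid => s.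
have /is_scalar_mxP[e ce] := c_central i s.
apply/matrixP => u v; rewrite [RHS]mxE.
have [C CE] := nceval_line (c i) r s.
have /fin_all_exists[P PE] : forall j, exists P : 'M[{poly F}]_n,
  forall x, nceval (f j) (line r s x) = map_mx (horner_eval x) P.
  by move=> j; exact: nceval_line.
pose Q : 'M[{poly F}]_(t, n * n) := \matrix_j mxvec (P j).
have QE x : evalmx f (line r s x) = map_mx (horner_eval x) Q.
  by apply/row_matrixP => j; rewrite -map_row !rowK map_mxvec PE.
(* [D] detects independence along the line: it is 1 at [r], where [B] is a right inverse, and
   vanishes wherever the [f j] are dependent. *)
pose D := \det (Q *m map_mx polyC B).
have DE x : D.[x] = \det (evalmx f (line r s x) *m B).
  rewrite QE -[LHS]/(horner_eval x _) -det_map_mx map_mxM; congr (\det (_ *m _)) => //.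
  by apply/matrixP => j k; rewrite !mxE /= horner_evalE hornerC.
(* Wherever [c i] does not vanish, the scalars [a j] form a nonzero vector in the left kernel, so
   [D] vanishes. *)
have : C u v * D = 0.
  apply: poly_eq0_pchar0 => x; rewrite hornerM DE.
  have -> : (C u v).[x] = nceval (c i) (line r s x) u v by rewrite CE mxE.
  have [-> | cx] := eqVneq (nceval (c i) (line r s x)) 0.
    by rewrite mxE mul0r.
  suff /eqP-> : \det (evalmx f (line r s x) *m B) == 0 by rewrite mulr0.
  have /fin_all_exists[a aE] : forall j, exists a,
    nceval (c j) (line r s x) = a%:M.
    by move=> j; apply/is_scalar_mxP/c_central.
  apply/det0P; exists (\row_j a j).
    apply: contraNneq cx => /rowP/(_ i); rewrite !mxE => ai0.
    by rewrite aE ai0 raddf0.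
  rewrite mulmxA mul_evalmx.
  have := cf0 (line r s x); rewrite nceval_lincomb => sum0.
  rewrite (_ : \sum_j _ = 0) ?linear0 ?mul0mx //; rewrite -[RHS]sum0.
  by apply: eq_bigr => j _; rewrite mxE aE mul_scalar_mx.
move=> /eqP; rewrite mulf_eq0 => /orP[] /eqP z.
  transitivity (C u v).[1]; last by rewrite z horner0.
  rewrite -[RHS]/(horner_eval 1 _).
  have -> : horner_eval 1 (C u v) = map_mx (horner_eval 1) C u v by rewrite mxE.
  rewrite -CE; congr (fun_of_matrix _ u v).
  by apply: eq_bigr => m _; congr (_ *: _); apply: eq_bigr => k _;
     rewrite /line scale1r addrC subrK.
have : D.[0] = 1.
  rewrite DE -[RHS](det1 F t) -fB; congr (\det (_ *m _)).
  apply/row_matrixP => j; rewrite !rowK; congr mxvec.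
  by apply: eq_bigr => m _; congr (_ *: _); apply: eq_bigr => k _;
     rewrite /line scale0r addr0.
by move/eqP; rewrite z horner0 eq_sym oner_eq0.
Qed.

End Backward.

(** * From local dependence to a central relation *)

Section Forward.
Variables (F : fieldType) (char0 : [pchar F] =i pred0).
Variables (n : nat) (n_gt0 : (0 < n)%N).
Local Notation N := (n * n)%N.

Definition central_dep t (f : 'I_t -> ncpoly F) :=
  exists c : 'I_t -> ncpoly F,
    [/\ forall i, central_poly n (c i),
        exists i, ~ poly_identity n (c i)
      & poly_identity n (nclincomb c f)].

Definition initseg t (f : 'I_t.+1 -> ncpoly F) (i : 'I_t) := f (widen_ord (leqnSn t) i).

Lemma central_dep_extend t (f : 'I_t.+1 -> ncpoly F) :
  central_dep (initseg f) -> central_dep f.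
Proof.
case=> c [c_central [i ci] cf0].
(* The new last coefficient is the zero polynomial [[::]]. *)
pose c' (j : 'I_t.+1) : ncpoly F := if insub (j : nat) is Some k then c k else [::].
have c'E k : c' (widen_ord (leqnSn t) k) = c k by rewrite /c' valK.
exists c'; split.
- move=> j r; rewrite /c'; case: insub => [k|]; first exact: c_central.
  by rewrite nceval_nil mx0_is_scalar.
- by exists (widen_ord (leqnSn t) i); rewrite c'E.
move=> r; rewrite nceval_lincomb big_ord_recr /= {2}/c' insubF ?ltnn //.
rewrite nceval_nil mul0mx addr0 -[RHS](cf0 r) nceval_lincomb.
by apply: eq_bigr => k _; rewrite c'E.
Qed.

Lemma central_dep_free_initseg t (f : 'I_t.+1 -> ncpoly F)
    (r0 : nat -> 'M[F]_n) :
  row_free (evalmx (initseg f) r0) -> loc_lin_dep n f -> central_dep f.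
Proof.
move=> free0 fdep.
have le_tN : (t <= N)%N by rewrite -(eqP free0) rank_leq_col.
pose M := (\max_i ncbound (f i))%N.
(* [g] completes the first [t] polynomials to [N] entries by fresh variables; [g' i] has the last
   polynomial in place [i]. The [c i] are the Cramer coefficients, negated except for the last. *)
pose g (k : 'I_N) := if insub (k : nat) is Some i then initseg f i
                     else ncvar F (cap_var M 2 k).
pose g' (i : 'I_t) (k : 'I_N) := if k == i :> nat then f ord_max else g k.
pose c (i : 'I_t.+1) := if insub (i : nat) is Some k
  then ncmul (ncconst (-1)) (nccapelli M (g' k)) else nccapelli M g.
have gE i : g (widen_ord le_tN i) = initseg f i by rewrite /g valK.
have cE i : c (widen_ord (leqnSn t) i) =
    ncmul (ncconst (-1)) (nccapelli M (g' i)) by rewrite /c valK.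
have cmax : c ord_max = nccapelli M g by rewrite /c insubF //= ltnn.
exists c; split.
- move=> i r; rewrite /c; case: insub => [k|]; last first.
    by rewrite nceval_capelli scalar_mx_is_scalar.
  by rewrite nceval_mul nceval_const nceval_capelli -scalar_mxM scalar_mx_is_scalar.
- exists ord_max; rewrite cmax.
  have [a [b ab0]] := capelli_scale_neq0 F n_gt0.
  have [U Uunit rowU] := row_free_complete le_tN free0.
  pose val (l : nat) k := if l is 0%N then a k else if l is 1%N then b k
                          else vec_mx (row k U).
  (* Below [M] the point is [r0], keeping the first [t] values; the fresh variables supply [a], [b]
     and the remaining rows of [U]. *)
  pose r v := if (v < M)%N then r0 v else
    if unpickle (v - M) is Some (l, k) then val l k else 0.
  have rE l k : r (cap_var M l k) = val l k.
    by rewrite /r /cap_var ltnNge leq_addr /= addKn pickleK.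
  move/(_ r)/eqP; rewrite nceval_capelli.
  have -> : vecrows (fun k => nceval (g k) r) = U.
    apply/row_matrixP => k; rewrite rowK.
    have [lt_kt | le_tk] := ltnP k t; last first.
      by rewrite /g insubF ?ltnNge ?le_tk // nceval_var rE /= vec_mxK.
    have -> : k = widen_ord le_tN (Ordinal lt_kt) by apply: val_inj.
    rewrite gE -rowU rowK; congr mxvec; apply: (@nceval_eq_below _ _ _ _ _ M).
      exact: (@leq_bigmax _ (fun i => ncbound (f i)) (widen_ord _ _)).
    by move=> i lt_iM; rewrite /r lt_iM.
  have -> : capelli_scale (fun k => r (cap_var M 0 k))
     (fun k => r (cap_var M 1 k)) = capelli_scale a b.
    by apply: eq_bigr => h _; congr (_ * \tr _); apply: eq_bigr => k _; rewrite !rE.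
  (* The scalar is a product of three nonzero factors: [n], by characteristic 0, [\det U] and
     [capelli_scale a b]. *)
  apply/negP/eqP => /matrixP/(_ (Ordinal n_gt0) (Ordinal n_gt0)) /eqP.
  rewrite !mxE eqxx mulr1n !mulf_eq0 (proj1 (pcharf0P F) char0) (negbTE ab0).
  by rewrite orbF (gtn_eqF n_gt0) -[_ == 0]negbK -unitfE -unitmxE Uunit.
move=> r; rewrite nceval_lincomb big_ord_recr /= cmax nceval_capelli.
set X := vecrows _; set d := capelli_scale _ _.
pose V := mxvec (nceval (f ord_max) r).
pose Y (j : 'I_N) : 'M[F]_N := \matrix_k (if k == j then V else row k X).
have YE i : vecrows (fun k => nceval (g' i k) r) = Y (widen_ord le_tN i).
  apply/row_matrixP => k; rewrite !rowK /g' -val_eqE /=.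
  by case: eqP => // _; rewrite rowK.
(* For [j] at least [t], the replacement overwrites a fresh row only, so [Y j] contains all the
   dependent rows of [evalmx f r]; the injection [h] locates them and carries [a] to a nonzero
   kernel vector. *)
have detY (j : 'I_N) : (t <= j)%N -> \det (Y j) = 0.
  move=> le_tj; have := fdep r; rewrite row_free_evalmx -kermx_eq0.
  case/rowV0Pn => a /sub_kermxP a0 a_neq0.
  pose h (i : 'I_t.+1) : 'I_N :=
    if insub (i : nat) is Some k then widen_ord le_tN k else j.
  have hw (k : 'I_t) : h (widen_ord (leqnSn t) k) = widen_ord le_tN k.
    by rewrite /h valK.
  have hm : h ord_max = j by rewrite /h insubF //= ltnn.
  have h_inj : injective h.
    move=> i1 i2 /(congr1 val) /=; rewrite /h.
    case: insubP => [k1 _ k1E|]; case: insubP => [k2 _ k2E|] //=.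
    - by move=> k12; apply: val_inj; rewrite /= -k1E -k2E.
    - by move=> _ k1j; move: le_tj; rewrite -k1j leqNgt ltn_ord.
    - by move=> _ jk2; move: le_tj; rewrite jk2 leqNgt ltn_ord.
    move=> i2t i1t _; apply: val_inj => /=.
    have lastE (i : 'I_t.+1) : ~~ (i < t)%N -> i = t :> nat.
      by rewrite -leqNgt => le_ti; apply/eqP; rewrite eqn_leq le_ti -ltnS ltn_ord.
    by rewrite (lastE _ i1t) (lastE _ i2t).
  have hY : rowsub h 1%:M *m Y j = evalmx f r.
    rewrite mul_rowsub_mx mul1mx; apply/row_matrixP => i; rewrite row_rowsub !rowK.
    case: (unliftP ord_max i) => [k ->|->]; last by rewrite hm eqxx.
    have -> : lift ord_max k = widen_ord (leqnSn t) k.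
      by apply: val_inj; rewrite /= /bump leqNgt ltn_ord.
    rewrite hw -val_eqE /= ltn_eqF ?(leq_trans (ltn_ord k)) //.
    by rewrite gE.
  apply/eqP/det0P; exists (a *m rowsub h 1%:M); last by rewrite -mulmxA hY.
  apply: contra_neq a_neq0 => /rowP ah; apply/rowP => i.
  have := ah (h i); rewrite !mxE (bigD1 i) //= big1 => [|k ki].
    by rewrite !mxE eqxx mulr1 addr0.
  by rewrite !mxE (inj_eq h_inj) (negbTE ki) mulr0.
have cramer : \det X *: nceval (f ord_max) r =
    \sum_(i < t) \det (Y (widen_ord le_tN i)) *: nceval (initseg f i) r.
  apply: (can_inj mxvecK); rewrite linearZ /= cramer_row.
  rewrite (bigID (fun k : 'I_N => (k < t)%N)) /= [X in _ + X]big1; last first.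
    by move=> k; rewrite -leqNgt => /detY detk; rewrite [\det _]detk scale0r.
  rewrite addr0 big_ord_narrow [RHS]linear_sum /=; apply: eq_bigr => i _.
  by rewrite linearZ /= rowK gE.
(* Cramer's rule multiplied by [n%:R * d] is the required relation, cancelling term by term. *)
rewrite mul_scalar_mx mulrCA mulrC -scalerA cramer scaler_sumr -big_split.
apply: big1 => i _ /=; rewrite cE nceval_mul nceval_const nceval_capelli.
rewrite YE -scalar_mxM mul_scalar_mx mulN1r scaleNr scalerA.
by rewrite [n%:R * (\det _ * _)]mulrCA [\det _ * _]mulrC addNr.
Qed.

(** Induction on [t] reduces to an initial segment that is independent at some point; for [t = 0]
    the empty family is free, against the hypothesis. *)
Lemma loc_lin_dep_central_dep t (f : 'I_t -> ncpoly F) :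
  loc_lin_dep n f -> central_dep f.
Proof.
elim: t f => [|t IHt] f fdep.
  have := fdep (fun _ => 0).
  by rewrite row_free_evalmx /row_free -leqn0 rank_leq_row.
have [gdep | /not_all_ex_not[r0 /negP]] := classic (loc_lin_dep n (initseg f)).
  exact/central_dep_extend/IHt.
rewrite negbK row_free_evalmx => free0; exact: central_dep_free_initseg free0 fdep.
Qed.

End Forward.

Theorem mainTheorem12 (F : fieldType) (char0 : [pchar F] =i pred0)
  (n : nat) (n_gt0 : (0 < n)%N) (t : nat) (f : 'I_t -> ncpoly F) :
  loc_lin_dep n f <->
  exists c : 'I_t -> ncpoly F,
    [/\ forall i, central_poly n (c i),
        exists i, ~ poly_identity n (c i)
      & poly_identity n (nclincomb c f)].
Proof.
split; first exact: (loc_lin_dep_central_dep char0 n_gt0).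
by case=> c [c_central [i ci] cf0]; apply: (central_comb_loc_lin_dep char0 c_central ci).
Qed.
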